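(* Let $\mathcal{A}\subseteq\mathbb{R}^k$ be a finite nonempty set, $d$ a metric on $\mathbb{R}^k$, $q\ge1$ and $C>0$. Let $B_0=B(x_0,r_0)$ be a ball of smallest radius among all balls $B$ satisfying $\mathcal{X}^*(A)\cap B\neq\emptyset$ for all nonempty $A\subseteq\mathcal{A}$. If $2r_0\le\sqrt[q]{C}$, then $\mathcal{Z}^*=\mathcal{Z}_C^*$.
   Context: A ball with center $x\in\mathbb{R}^k$ and radius $r>0$ is $B(x,r)=\{y\in\mathbb{R}^k : d(x,y)\le r\}$. $d^q(x,y)=(d(x,y))^q$. For a finite set $A\subseteq\mathbb{R}^k$, $\mathcal{X}^*(A)$ is the set of minimizers over $x\in\mathbb{R}^k$ of $f(x,A)=\sum_{a\in A} d^q(x,a)$. The optimal values are $\mathcal{Z}^*=\min_{x\in\mathbb{R}^k} f(x,\mathcal{A})$ and $\mathcal{Z}_C^*=\min_{x\in\mathbb{R}^k}\sum_{a\in\mathcal{A}}\min\{d^q(x,a),C\}$; all minima are understood to be attained (automatic if $d$ is derived from a norm). *)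

(* Defs.v *)
From mathcomp Require Import all_boot all_order all_algebra finmap.
From mathcomp Require Import all_classical all_reals all_analysis.

Set Implicit Arguments.
Unset Strict Implicit.
Unset Printing Implicit Defensive.

Import Order.TTheory GRing.Theory Num.Theory.

Local Open Scope classical_set_scope.
Local Open Scope ring_scope.

(* The metric is a bare function, not a [metricType] instance: it is arbitrary
   and unrelated to the canonical topology of ['rV[R]_k]. *)
Record is_metric (R : realType) (T : Type) (d : T -> T -> R) : Prop := IsMetric {
  is_metric_ge0 : forall x y, 0 <= d x y ;
  is_metric_eq0 : forall x y, d x y = 0 <-> x = y ;
  is_metric_sym : forall x y, d x y = d y x ;
  is_metric_triangle : forall x y z, d x z <= d x y + d y z
}.

Definition is_min (R : realType) (T : Type) (F : T -> R) (m : R) : Prop :=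
  range F m /\ lbound (range F) m.

Section Location.
Context (R : realType) (k : nat).
Implicit Types (d : 'rV[R]_k -> 'rV[R]_k -> R) (q C r : R) (x : 'rV[R]_k)
  (A : {fset 'rV[R]_k}).

Definition cball d x r : set 'rV[R]_k := [set y | d x y <= r].

Definition cost d q A x : R := \sum_(a <- A) d x a `^ q.

Definition capped_cost d q C A x : R :=
  \sum_(a <- A) Num.min (d x a `^ q) C.

Definition minimizers d q A : set 'rV[R]_k :=
  [set x | forall y, cost d q A x <= cost d q A y].

Definition meets_all_minimizers d q A x r : Prop :=
  forall A' : {fset 'rV[R]_k}, (A' `<=` A)%fset -> A' != fset0 ->
    minimizers d q A' `&` cball d x r !=set0.

(* Balls have positive radius; the center is free in the comparison. *)
Definition smallest_ball d q A x0 r0 : Prop :=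
  [/\ 0 < r0, meets_all_minimizers d q A x0 r0 &
      forall x r, 0 < r -> meets_all_minimizers d q A x r -> r0 <= r].

End Location.

(* Main.v *)
(** Each singleton [{a}] has [a] as its only minimizer, so [B(x0, r0)] contains
    all of [A]; hence every point [z] of the ball satisfies
    [d(z, a)^q <= (2 r0)^q <= C] for all [a] in [A].  Given any [y], let [A'] be
    the points whose cost at [y] is not capped and let [z] be a minimizer for
    [A'] lying in the ball (any point of the ball if [A'] is empty).  On [A'] the
    uncapped cost of [z] is at most that of [y], and off [A'] each term is at
    most [C], so the uncapped cost of [z] is at most the capped cost of [y]. *)
Require Import Defs.
From mathcomp Require Import all_boot all_order all_algebra finmap.
From mathcomp Require Import all_classical all_reals all_analysis.

Import Order.TTheory GRing.Theory Num.Theory.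

Local Open Scope ring_scope.

(** The point [a] itself has cost [0], since a power of [0] with exponent [q != 0] vanishes; a
    minimizer is then at distance [0] from [a]. *)
Lemma minimizers_fset1 (R : realType) (k : nat)
    (d : 'rV[R]_k -> 'rV[R]_k -> R) (q : R) (a y : 'rV[R]_k) :
  is_metric d -> q != 0 -> minimizers d q [fset a]%fset y -> y = a.
Proof.
move=> hd q0 /(_ a); rewrite /cost !big_seq_fset1.
rewrite (proj2 (is_metric_eq0 hd a a)) // powR0 // => dya.
have /eqP : d y a `^ q = 0 by apply/eqP; rewrite eq_le dya powR_ge0.
by rewrite powR_eq0 => /andP[/eqP /(is_metric_eq0 hd)].
Qed.

Lemma meets_all_minimizers_center (R : realType) (k : nat)
    (d : 'rV[R]_k -> 'rV[R]_k -> R) (q : R) (A : {fset 'rV[R]_k})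
    (x : 'rV[R]_k) (r : R) :
  is_metric d -> q != 0 -> meets_all_minimizers d q A x r ->
  forall a, a \in A -> d x a <= r.
Proof.
move=> hd q0 hB a aA.
have a1A : ([fset a] `<=` A)%fset by rewrite fsub1set.
have a1N0 : [fset a]%fset != fset0 by apply/fset0Pn; exists a; rewrite in_fset1.
by have [y [/(minimizers_fset1 _ _ _ _ _ _ hd q0) ->]] := hB _ a1A a1N0.
Qed.

Lemma capped_cost_le_cost (R : realType) (k : nat)
    (d : 'rV[R]_k -> 'rV[R]_k -> R) (q C : R) (A : {fset 'rV[R]_k})
    (x : 'rV[R]_k) :
  capped_cost d q C A x <= cost d q A x.
Proof. by apply: ler_sum => a _; rewrite ge_min lexx. Qed.

Lemma exists_cost_le_capped_cost (R : realType) (k : nat)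
    (d : 'rV[R]_k -> 'rV[R]_k -> R) (q C : R) (A : {fset 'rV[R]_k})
    (x0 : 'rV[R]_k) (r0 : R) (y : 'rV[R]_k) :
  is_metric d -> 0 < q -> 0 <= C -> 0 <= r0 ->
  meets_all_minimizers d q A x0 r0 -> 2 * r0 <= C `^ q^-1 ->
  exists z, cost d q A z <= capped_cost d q C A y.
Proof.
move=> hd q_gt0 C_ge0 r0_ge0 hB hr.
have q0 : q != 0 by rewrite gt_eqF.
have capC z a : d x0 z <= r0 -> a \in A -> d z a `^ q <= C.
  move=> zB aA; have aB := meets_all_minimizers_center _ _ _ _ _ _ _ hd q0 hB a aA.
  have dza : d z a <= C `^ q^-1.
    apply: le_trans hr; apply: le_trans (is_metric_triangle hd z x0 a) _.
    by rewrite (is_metric_sym hd z) mulr_natl mulr2n lerD.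
  (* Writing [C] as the [q]-th power of its [q]-th root leaves monotonicity of powers. *)
  rewrite -[leRHS](powRr1 C_ge0) -(mulVf q0) powRrM.
  apply: ge0_ler_powR => //; rewrite ?nnegrE ?powR_ge0 ?(is_metric_ge0 hd) //.
  exact: ltW.
pose A' := [fset a in A | d y a `^ q <= C]%fset.
have [z zB zA'] : exists2 z, d x0 z <= r0 & cost d q A' z <= cost d q A' y.
  (* The ball condition concerns nonempty subsets only; for empty [A'] the center serves. *)
  have [A'0|A'N0] := eqVneq A' fset0.
    exists x0; first by rewrite (proj2 (is_metric_eq0 hd _ _)).
    by rewrite A'0 /cost !big_seq_fset0.
  have [z [zmin zB]] := hB A' (fset_sub A _) A'N0.
  by exists z; [exact: zB | exact: zmin].
exists z; rewrite /cost /capped_cost.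
rewrite (bigID (fun a => d y a `^ q <= C)).
rewrite [leRHS](bigID (fun a => d y a `^ q <= C)) /=.
apply: lerD.
  rewrite [leRHS](eq_bigr (fun a => d y a `^ q)); last by move=> a /min_l.
  by rewrite !(big_fset_condE _ A (fun a => d y a `^ q <= C)).
(* The bound [capC] requires [a \in A], recovered here. *)
rewrite big_seq_cond [leRHS]big_seq_cond; apply: ler_sum => a /andP[aA].
by rewrite -ltNge => /ltW /min_r ->; exact: capC.
Qed.

Theorem theorem13 (R : realType) (k : nat) (A : {fset 'rV[R]_k})
    (d : 'rV[R]_k -> 'rV[R]_k -> R) (q C : R)
    (x0 : 'rV[R]_k) (r0 : R) (Z ZC : R)
    (hA : A != fset0) (hd : is_metric d) (hq : 1 <= q) (hC : 0 < C)
    (hB : smallest_ball d q A x0 r0)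
    (hZ : is_min (cost d q A) Z) (hZC : is_min (capped_cost d q C A) ZC)
    (hr : 2 * r0 <= C `^ q^-1) :
  Z = ZC.
Proof.
case: hB hZ hZC => r0_gt0 hB _ [[x _ <-] lbZ] [[y _ <-] lbZC].
apply/eqP; rewrite eq_le; apply/andP; split.
  (* Here [y] attains [ZC], and [Z] is at most the cost of [z]. *)
  have [z] := exists_cost_le_capped_cost _ _ _ _ _ _ _ _ y hd
    (lt_le_trans ltr01 hq) (ltW hC) (ltW r0_gt0) hB hr.
  by apply: le_trans; apply: lbZ; exists z.
by apply: le_trans (capped_cost_le_cost _ _ _ _ _ _ x); apply: lbZC; exists x.
Qed.
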